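(* For every $n\geqslant 3$ and every field $K$, the algebra $K[C_n]$ is right and left Noetherian.
   Context: For $n\ge 3$, $C_n$ denotes the Hecke--Kiselman monoid of the oriented cycle $x_1\to x_2\to\cdots\to x_n\to x_1$: the monoid generated by $x_1,\dots,x_n$ with relations (indices modulo $n$) $x_i^2=x_i$ for all $i$; $x_ix_j=x_jx_i$ if $i,j$ are distinct and not cyclically adjacent; $x_ix_{i+1}x_i=x_{i+1}x_ix_{i+1}=x_ix_{i+1}$ for all $i$. $K[C_n]$ is its monoid algebra over $K$. *)

(* Defs.v *)
From HB Require Import structures.
From mathcomp Require Import all_boot all_algebra generic_quotient boolp.
From mathcomp Require Import monalg.

Set Implicit Arguments.
Unset Strict Implicit.
Unset Printing Implicit Defensive.

Import GRing.Theory.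
Local Open Scope quotient_scope.

(* The vertex x_(i+1) of the cycle is [i : 'I_n], and [ordS i] is its cyclic
   successor, so the arrows are [i -> ordS i].  A word in the generators is a
   [seq 'I_n]. *)
Section HeckeKiselmanCycle.
Variable n : nat.

Inductive hkc_rel : seq 'I_n -> seq 'I_n -> Prop :=
| hkc_idem i : hkc_rel [:: i; i] [:: i]
| hkc_comm i j : i != j -> j != ordS i -> i != ordS j ->
    hkc_rel [:: i; j] [:: j; i]
| hkc_braidl i : hkc_rel [:: i; ordS i; i] [:: i; ordS i]
| hkc_braidr i : hkc_rel [:: ordS i; i; ordS i] [:: i; ordS i].

Inductive hkc_cong : seq 'I_n -> seq 'I_n -> Prop :=
| hkc_cong_rel u v : hkc_rel u v -> hkc_cong u v
| hkc_cong_refl u : hkc_cong u u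
| hkc_cong_sym u v : hkc_cong u v -> hkc_cong v u
| hkc_cong_trans u v w : hkc_cong u v -> hkc_cong v w -> hkc_cong u w
| hkc_cong_cat u u' v v' :
    hkc_cong u u' -> hkc_cong v v' -> hkc_cong (u ++ v) (u' ++ v').

Definition hkc_congb : rel (seq 'I_n) := fun u v => `[< hkc_cong u v >].

Lemma hkc_congb_refl : reflexive hkc_congb.
Proof. by move=> u; apply/asboolP/hkc_cong_refl. Qed.

Lemma hkc_congb_sym : symmetric hkc_congb.
Proof. by move=> u v; apply/asboolP/asboolP; apply: hkc_cong_sym. Qed.

Lemma hkc_congb_trans : transitive hkc_congb.
Proof.
move=> v u w /asboolP uv /asboolP vw; apply/asboolP.
exact: hkc_cong_trans uv vw.
Qed.

Canonical hkc_equiv :=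
  EquivRel hkc_congb hkc_congb_refl hkc_congb_sym hkc_congb_trans.

Definition hkc := {eq_quot hkc_equiv}.
HB.instance Definition _ := Choice.on hkc.
HB.instance Definition _ := EqQuotient.on hkc.

Definition hkc_word (u : seq 'I_n) : hkc := \pi_hkc u.

Lemma hkc_wordP u v : hkc_word u = hkc_word v <-> hkc_cong u v.
Proof.
split=> [/eqmodP/asboolP//|uv].
by apply/eqmodP/asboolP.
Qed.

Lemma hkc_reprK (x : hkc) : hkc_word (repr x) = x.
Proof. exact: reprK. Qed.

Definition hkc_one : hkc := hkc_word [::].
Definition hkc_mul (x y : hkc) : hkc := hkc_word (repr x ++ repr y).

Lemma hkc_mul_word u v : hkc_mul (hkc_word u) (hkc_word v) = hkc_word (u ++ v).
Proof. by apply/hkc_wordP/hkc_cong_cat; apply/hkc_wordP/hkc_reprK. Qed.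

Lemma hkc_mulA : associative hkc_mul.
Proof.
move=> x y z; rewrite -[x]hkc_reprK -[y]hkc_reprK -[z]hkc_reprK.
by rewrite !hkc_mul_word catA.
Qed.

Lemma hkc_mul1m : left_id hkc_one hkc_mul.
Proof. by move=> x; rewrite -[x]hkc_reprK hkc_mul_word. Qed.

Lemma hkc_mulm1 : right_id hkc_one hkc_mul.
Proof. by move=> x; rewrite -[x]hkc_reprK hkc_mul_word cats0. Qed.

Lemma hkc_cong_nil u v : hkc_cong u v -> nilp u = nilp v.
Proof.
elim=> {u v} [u v [] // | // | // | u v w _ -> _ -> // |].
by move=> u u' v v' _ + _; rewrite /nilp !size_cat !addn_eq0 => -> ->.
Qed.

(* [monomType] requires that only the identity be invertible; this holds
   because no defining relation has an empty side. *)
Lemma hkc_unitm x y : hkc_mul x y = hkc_one -> x = hkc_one /\ y = hkc_one.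
Proof.
rewrite -[x]hkc_reprK -[y]hkc_reprK hkc_mul_word => /hkc_wordP/hkc_cong_nil.
by case: (repr x) => [|? ?] //; case: (repr y).
Qed.

HB.instance Definition _ := Choice_isMonomialDef.Build hkc
  hkc_mulA hkc_mul1m hkc_mulm1 hkc_unitm.

End HeckeKiselmanCycle.

Local Open Scope ring_scope.

Section Noetherian.
Variable R : nzRingType.
Implicit Types I J : R -> Prop.

(* Closure under opposites follows from absorption of [-1]. *)
Definition left_ideal I : Prop :=
  [/\ I 0, forall x y, I x -> I y -> I (x + y) & forall a x, I x -> I (a * x)].

Definition right_ideal I : Prop :=
  [/\ I 0, forall x y, I x -> I y -> I (x + y) & forall a x, I x -> I (x * a)].

Definition ascending_chain_condition (P : (R -> Prop) -> Prop) : Prop :=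
  forall I : nat -> R -> Prop,
    (forall k, P (I k)) -> (forall k x, I k x -> I k.+1 x) ->
    exists N : nat, forall k, (N <= k)%N -> forall x, I k x <-> I N x.

Definition left_noetherian : Prop := ascending_chain_condition left_ideal.
Definition right_noetherian : Prop := ascending_chain_condition right_ideal.

End Noetherian.

(* Main.v *)
Require Import Defs.
From mathcomp Require Import all_boot all_algebra finmap boolp monalg.

(** The monoid [C_n] acts on the natural numbers, [x_i] moving every [p] in the
    residue class [i] modulo [n] to [p + 1] and fixing the others; the leftmost
    letter acts first.  The resulting maps are nondecreasing, commute with
    [p |-> p + n] and satisfy [p <= f p].  Two facts about this action, together
    with a leading-monomial argument, give the theorem.

    The action is faithful ([act_faithful]), and its image consists of the
    identity and of all such maps whose values miss a residue class
    ([word_of]).  Both rest on one construction: if the values of [f] miss the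
    class [i] but not the class [i + 1], then lowering from [i + 1] to [i]
    every value that can be lowered gives a map [low i f] of smaller degree
    with [f = step i \o low i f].  Two words ending in [i] and [j] with the
    same action [f] are compared through lowerings of [f], by induction on
    the degree, that is, on the sum of the values over a period.

    The map [T : f |-> f + n] preserves the image without the identity, which is
    a finite union of chains [g, T g, T (T g), ...].  For every such [f] and
    [k > 0], some [h] satisfies [f * h = T^k f], while
    [g * h <= T^k g] pointwise for all [g] ([right_translation]); similarly
    for multiplication by some [h] on the left ([left_translation]).
    Order the maps by degree, and maps of the same degree by the chain to which
    they belong, which [T] does not change.  If [g] is smaller than [f], then
    [g * h] is smaller than [T^k f]: either [g * h] has smaller degree than
    [T^k g], or [g * h = T^k g].  Hence the leading monomial of [x * h] is
    [T^k f] when the leading monomial of [x] is [f], and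
    the leading monomials of a one-sided ideal form a subset of finitely many
    chains, closed under [T].  Such subsets satisfy the ascending chain
    condition, and a subspace is determined within a larger one by its set of
    leading monomials, since the order is that of the natural numbers
    ([acc_of_leading]). *)

Set Implicit Arguments.
Unset Strict Implicit.
Unset Printing Implicit Defensive.

Import GRing.Theory.

(** * Chains of subspaces and leading monomials *)

Section LeadingMonomials.
Variables (M : choiceType) (K : fieldType) (key : M -> nat).
Hypothesis key_inj : injective key.
Implicit Types (x y : {malg K[M]}) (m : M).

Definition leads x m : Prop :=
  (x@_m != 0)%R /\ forall m', (x@_m' != 0)%R -> key m' <= key m.

Definition subspace (I : {malg K[M]} -> Prop) : Prop :=
  I 0%R /\ forall c x y, I x -> I y -> I (c *: x + y)%R.

Lemma leads_exists x : (x != 0)%R -> exists m, leads x m.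
Proof.
move=> x0.
have [m0 m0x] : exists m, m \in msupp x.
  apply: contrapT => supp0; case/eqP: x0; apply/malgP => m; rewrite mcoeff0.
  by apply: mcoeff_outdom; apply/negP => mx; apply: supp0; exists m.
have ex : exists k, has (fun m => key m == k) (msupp x).
  by exists (key m0); apply/hasP; exists m0.
have bd k : has (fun m => key m == k) (msupp x) ->
    k <= \max_(m <- msupp x) key m.
  by move=> /hasP[m mx /eqP <-]; apply: leq_bigmax_seq.
case: (ex_maxnP ex bd) => _ /hasP[m mx /eqP <-] max.
exists m; split=> [|m']; rewrite mcoeff_neq0 // => m'x.
by apply: max; apply/hasP; exists m'.
Qed.

Lemma leads_cancel x y m : leads x m -> leads y m ->
  forall m', ((- (x@_m / y@_m) *: y + x)%R@_m' != 0)%R -> key m' < key m.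
Proof.
move=> [xm xle] [ym yle] m'; rewrite mcoeffD mcoeffZ => nz.
rewrite ltn_neqAle; apply/andP; split.
  apply: contraNneq nz => /key_inj ->.
  by rewrite mulNr divfK // addNr.
have [/xle //|/negPn/eqP x0] := boolP (x@_m' != 0)%R.
have [/yle //|/negPn/eqP y0] := boolP (y@_m' != 0)%R.
by move: nz; rewrite x0 y0 mulr0 addr0 eqxx.
Qed.

(** The map [cls] divides the monomials into finitely many chains, ordered by
    [key].  By the third hypothesis the leading monomials of [I k] contain,
    with a monomial, all later ones of its chain.  So the leading monomials
    of the union of the [I k] are generated by the first one of each chain,
    and all of these occur already in some [I N].  Reducing an element of [I k]
    by elements of [I N] then lowers its leading monomial until it vanishes. *)
Lemma acc_of_leading (T : finType) (cls : M -> T)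
    (I : nat -> {malg K[M]} -> Prop) :
    (forall k, subspace (I k)) ->
    (forall k x, I k x -> I k.+1 x) ->
    (forall k x m m', I k x -> leads x m -> cls m = cls m' ->
       key m <= key m' -> exists2 y, I k y & leads y m') ->
  exists N, forall k, N <= k -> forall x, I k x <-> I N x.
Proof.
move=> sub incr shift.
have mono k l x : k <= l -> I k x -> I l x.
  move=> /subnKC <-; elim: (l - k) => [|d IH] Ix; first by rewrite addn0.
  by rewrite addnS; apply/incr/IH.
have stab c : exists N, forall m k x, cls m = c -> I k x -> leads x m ->
    exists2 y, I N y & leads y m.
  (* The monomial of least key that occurs in the chain [c] decides for it. *)
  pose P j := `[< exists m k x, [/\ cls m = c, I k x, leads x m & key m = j] >].
  have [exP|noP] := pselect (exists j, P j); last first.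
    exists 0 => m k x mc Ix xm; case: noP.
    by exists (key m); apply/asboolP; exists m, k, x.
  case: (ex_minnP exP) => j /asboolP[m [N [y [mc Iy ym <-]]]] min.
  exists N => m' k x m'c Ix xm'.
  apply: (shift N y m) => //; first by rewrite mc m'c.
  by apply: min; apply/asboolP; exists m', k, x.
have [f fP] := choice stab.
pose N := \max_(c : T) f c; exists N => k Nk x; split; last exact: mono.
have main B x' : (forall m, (x'@_m != 0)%R -> key m < B) -> I k x' -> I N x'.
  elim: B x' => [|B IH] z zB Iz.
    have [->|/leads_exists[m [/zB]]//] := eqVneq z 0%R.
    exact: (sub N).1.
  have [->|z0] := eqVneq z 0%R; first exact: (sub N).1.
  have [m zm] := leads_exists z0.
  have [y Iy ym] := fP (cls m) m k z erefl Iz zm.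
  have {}Iy : I N y by apply: mono Iy; apply: leq_bigmax.
  pose a := (z@_m / y@_m)%R.
  have -> : z = (a *: y + (- a *: y + z))%R by rewrite addrA scaleNr subrr add0r.
  apply: (sub N).2 => //; apply: IH => [m' nz|].
    exact: leq_trans (leads_cancel zm ym nz) (zB m zm.1).
  by apply: (sub k).2 => //; apply: mono Iy.
move=> Ix.
have [->|x0] := eqVneq x 0%R; first exact: (sub N).1.
have [m [_ le]] := leads_exists x0.
by apply: (main (key m).+1) Ix.
Qed.

End LeadingMonomials.

Section LinearExtension.
Variables (M : choiceType) (K : fieldType) (key : M -> nat).
Hypothesis key_inj : injective key.

(** No cancellation can reach [phi m], even if [phi] is not injective: all other
    monomials are sent strictly below it. *)
Lemma leads_push (phi : M -> M) (x : {malg K[M]}) m :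
    leads key x m ->
    (forall m', key m' < key m -> key (phi m') < key (phi m)) ->
  leads key (\sum_(k <- msupp x) << x@_k *g phi k >>)%R (phi m).
Proof.
move=> [xm xle] phi_lt.
have coef g : ((\sum_(k <- msupp x) << x@_k *g phi k >>)@_g =
    \sum_(k <- msupp x) x@_k *+ (phi k == g))%R.
  by rewrite raddf_sum; apply: eq_bigr => k _; rewrite /= mcoeffU.
have ltE k : k \in msupp x -> k != m -> key (phi k) < key (phi m).
  rewrite -mcoeff_neq0 => /xle; rewrite leq_eqVlt => /orP[/eqP/key_inj ->|].
    by rewrite eqxx.
  by move=> /phi_lt.
split=> [|g]; rewrite coef.
  rewrite (bigD1_seq m) ?fset_uniq -?mcoeff_neq0 //= eqxx mulr1n.
  rewrite big_seq_cond big1 ?addr0 // => k /andP[/ltE/[apply]].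
  by case: eqP => // ->; rewrite ltnn.
apply: contraNT; rewrite -ltnNge => mg; apply/eqP.
rewrite big_seq big1 // => k kx; case: eqP => // kg; move: mg; rewrite -kg.
have [-> | /(ltE _ kx)] := eqVneq k m; first by rewrite ltnn.
by move=> /ltnW; rewrite leqNgt => /negbTE ->.
Qed.

End LinearExtension.

(** * Noetherian monoid algebras *)

Section NoetherianMonoidAlgebra.
Variables (M : monomType) (K : fieldType) (T : finType).
Variables (key : M -> nat) (cls : M -> T).
Hypothesis key_inj : injective key.

Lemma malg_mulU (x : {malg K[M]}) h :
  (x * << h >> = \sum_(k <- msupp x) << x@_k *g mmul k h >>)%R.
Proof.
by rewrite malgM_def fgmulgU; apply: eq_bigr => k _; rewrite mulr1.
Qed.

Lemma malg_Umul (x : {malg K[M]}) h :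
  (<< h >> * x = \sum_(k <- msupp x) << x@_k *g mmul h k >>)%R.
Proof.
by rewrite malgM_def fgmulUg; apply: eq_bigr => k _; rewrite mul1r.
Qed.

Lemma malg_mulC (x : {malg K[M]}) c : (x * c%:MP = c *: x)%R.
Proof.
rewrite malgM_def fgmulgU malgZ_def; apply: eq_bigr => k _.
by rewrite mulm1 mulrC.
Qed.

(** Multiplication by the single monomial [h] moves the leading monomial [m] of
    any element to [m'], so that chains of ideals fall under
    [acc_of_leading].  The element [h] depends on [m], and multiplication by it
    is compared only below [m]: in a monoid without cancellation no strictly
    compatible total order exists. *)
Lemma right_noetherian_malg :
    (forall m m', cls m = cls m' -> key m <= key m' ->
       exists2 h, mmul m h = m' &
         forall k, key k < key m -> key (mmul k h) < key m') ->
  right_noetherian {malg K[M]}.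
Proof.
move=> shift I idI incr; apply: (acc_of_leading key_inj (cls := cls)) => //.
  move=> k; have [I0 ID IM] := idI k; split=> // c x y Ix Iy.
  by apply: ID => //; rewrite -malg_mulC; apply: IM.
move=> k x m m' Ix xm /shift/[apply] -[h mh lt].
exists (x * << h >>)%R; first by have [_ _] := idI k; apply.
by rewrite malg_mulU -mh; apply: (leads_push key_inj (phi := mmul^~ h)) => //;
  rewrite mh.
Qed.

Lemma left_noetherian_malg :
    (forall m m', cls m = cls m' -> key m <= key m' ->
       exists2 h, mmul h m = m' &
         forall k, key k < key m -> key (mmul h k) < key m') ->
  left_noetherian {malg K[M]}.
Proof.
move=> shift I idI incr; apply: (acc_of_leading key_inj (cls := cls)) => //.
  move=> k; have [I0 ID IM] := idI k; split=> // c x y Ix Iy.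
  by apply: ID => //; rewrite -mul_malgC; apply: IM.
move=> k x m m' Ix xm /shift/[apply] -[h mh lt].
exists (<< h >> * x)%R; first by have [_ _] := idI k; apply.
by rewrite malg_Umul -mh; apply: (leads_push key_inj (phi := mmul h)) => //;
  rewrite mh.
Qed.

End NoetherianMonoidAlgebra.

(** * The action of words on the natural numbers *)

Section AffineCatalanMaps.
Variable n : nat.
Hypothesis n_ge3 : 2 < n.
Implicit Types (i j a b : 'I_n) (f g : nat -> nat) (u v w : seq 'I_n).

Lemma n_gt0 : 0 < n. Proof. exact: ltnW (ltnW n_ge3). Qed.

Definition cl p : 'I_n := Ordinal (ltn_pmod p n_gt0).

Lemma cl_eqP p q : reflect (p = q %[mod n]) (cl p == cl q).
Proof. by apply: (iffP eqP) => [[]|e]; last exact: val_inj. Qed.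

Lemma cl_ord i : cl i = i.
Proof. by apply: val_inj; rewrite /= modn_small. Qed.

Lemma clS p : cl p.+1 = ordS (cl p).
Proof. by apply: val_inj; rewrite /= -addn1 -[in RHS]addn1 modnDml. Qed.

Lemma cl_shift p k : cl (p + k * n) = cl p.
Proof. by apply: val_inj; rewrite /= addnC modnMDl. Qed.

Lemma cl_addn p : cl (p + n) = cl p.
Proof. by rewrite -[n in p + n]mul1n cl_shift. Qed.

Lemma cl_pred p q i : q < p -> cl p = ordS i -> cl p.-1 = i.
Proof. by case: p => // p _; rewrite clS => /ordS_inj. Qed.

Lemma cl_cofinal p q : cl p = cl q -> exists k l, p + k * n = q + l * n.
Proof.
move=> [e]; exists (q %/ n), (p %/ n).
rewrite {1}(divn_eq p n) {2}(divn_eq q n) e.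
by rewrite [LHS]addnC [X in _ + X]addnC addnA.
Qed.

Lemma cl_between p i : exists2 q, p < q <= p + n & cl q = i.
Proof.
exists (p.+1 + (i + n - p.+1 %% n) %% n).
  by rewrite addSn ltnS leq_addr /= -addnS leq_add2l ltn_pmod ?n_gt0.
apply: val_inj; rewrite /= modnDmr -modnDml subnKC; last first.
  exact: leq_trans (ltnW (ltn_pmod _ n_gt0)) (leq_addl _ _).
by rewrite modnDr modn_small.
Qed.

Lemma ordS_neq i : (ordS i == i) = false.
Proof.
rewrite -(cl_ord i) -clS; apply/negbTE/cl_eqP => /eqP.
by rewrite -addn1 -{2}[val i]addn0 eqn_modDl mod0n modn_small // ltnW.
Qed.

Lemma ordSS_neq i : (ordS (ordS i) == i) = false.
Proof.
rewrite -(cl_ord i) -!clS; apply/negbTE/cl_eqP => /eqP.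
by rewrite -addn2 -{2}[val i]addn0 eqn_modDl mod0n modn_small.
Qed.

Lemma ordS_eq i j : (ordS i == ordS j) = (i == j).
Proof. exact: inj_eq (@ordS_inj n) i j. Qed.

Definition step i p := if cl p == i then p.+1 else p.
Definition act u p := foldl (fun q i => step i q) p u.

Lemma act_cat u v p : act (u ++ v) p = act v (act u p).
Proof. exact: foldl_cat. Qed.

Lemma act_rcons u i p : act (rcons u i) p = step i (act u p).
Proof. exact: foldl_rcons. Qed.

Lemma step_eq i p : cl p = i -> step i p = p.+1.
Proof. by move=> <-; rewrite /step eqxx. Qed.

Lemma step_neq i p : cl p != i -> step i p = p.
Proof. by rewrite /step => /negbTE ->. Qed.

Lemma step_ge i p : p <= step i p.
Proof. by rewrite /step; case: ifP. Qed.

Lemma act_rel u v : hkc_rel u v -> act u =1 act v.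
Proof.
case=> [i|i j ij ji ij'|i|i] p; rewrite /act /=.
- have [e|ne] := eqVneq (cl p) i; last by rewrite !(step_neq ne).
  by rewrite (step_eq e) step_neq // clS e ordS_neq.
- have [e|ne] := eqVneq (cl p) i.
    rewrite (step_eq e) (@step_neq j p) ?e // (step_eq e) step_neq //.
    by rewrite clS e eq_sym.
  rewrite (step_neq ne); have [e|ne'] := eqVneq (cl p) j.
    by rewrite (step_eq e) step_neq // clS e eq_sym.
  by rewrite !step_neq.
- have [e|ne] := eqVneq (cl p) i.
    have e1 : cl p.+1 = ordS i by rewrite clS e.
    by rewrite (step_eq e) (step_eq e1) step_neq // clS e1 ordSS_neq.
  rewrite (step_neq ne); have [e|ne'] := eqVneq (cl p) (ordS i).
    by rewrite (step_eq e) step_neq // clS e ordSS_neq.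
  by rewrite !step_neq.
- have [e|ne] := eqVneq (cl p) i.
    have e1 : cl p.+1 = ordS i by rewrite clS e.
    by rewrite (@step_neq (ordS i) p) ?e 1?eq_sym ?ordS_neq // (step_eq e).
  rewrite (step_neq ne); have [e|ne'] := eqVneq (cl p) (ordS i).
    have e1 : cl p.+1 = ordS (ordS i) by rewrite clS e.
    rewrite (step_eq e) (@step_neq i) ?e1 ?ordSS_neq // step_neq //.
    by rewrite e1 ordS_neq.
  by rewrite !step_neq.
Qed.

Lemma act_cong u v : hkc_cong u v -> act u =1 act v.
Proof.
elim=> {u v} [u v|//|u v _ IH|u v w _ IH1 _ IH2|u u' v v' _ IH1 _ IH2] p //.
- exact: act_rel.
- by rewrite IH1.
- by rewrite !act_cat IH1 IH2.
Qed.

(** * Affine Catalan maps *)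

Definition catalan f : Prop :=
  [/\ {homo f : p q / p <= q}, forall p, f (p + n) = f p + n
    & forall p, p <= f p].

Definition misses i f := forall p, cl (f p) != i.
Definition nonsurj f := exists i, misses i f.

Lemma catalan_periods f p k : catalan f -> f (p + k * n) = f p + k * n.
Proof.
move=> [_ per _]; elim: k => [|k IH]; first by rewrite !addn0.
by rewrite mulSn addnCA addnC per IH -addnA [_ + n]addnC.
Qed.

Lemma catalan_step i : catalan (step i).
Proof.
split=> [p q|p|p]; last exact: step_ge.
  rewrite leq_eqVlt => /orP[/eqP-> //|pq].
  apply: leq_trans (step_ge i q); rewrite /step.
  by case: ifP => // _; apply: ltnW.
by rewrite /step cl_addn; case: ifP.
Qed.

Lemma catalan_act u : catalan (act u).
Proof.
elim/last_ind: u => [|u i [mono per ext]]; first by split.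
have [mono' per' ext'] := catalan_step i.
split=> [p q pq|p|p]; rewrite !act_rcons.
- by apply/mono'/mono.
- by rewrite per per'.
- exact: leq_trans (ext p) (ext' _).
Qed.

Lemma catalan_hit f i p : catalan f -> cl (f p) = i ->
  forall q, exists2 r, q <= r & cl (f r) = i.
Proof.
move=> catf <- q; exists (p + q * n); last by rewrite catalan_periods // cl_shift.
by rewrite (leq_trans _ (leq_addl _ _)) // leq_pmulr ?n_gt0.
Qed.

(** A value skipped between [p] and [p + 1] is skipped in every period, by
    monotonicity. *)
Lemma misses_gap f p q : catalan f -> f p < q < f p.+1 -> misses (cl q) f.
Proof.
move=> catf /andP[lo hi] r; apply/eqP => /cl_cofinal[k [l e]].
have [mono _ _] := catf.
have [rp|pr] := leqP (r + k * n) (p + l * n).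
  by have := mono _ _ rp; rewrite !catalan_periods // e leq_add2r leqNgt lo.
have /mono : p.+1 + l * n <= r + k * n by rewrite addSn.
by rewrite !catalan_periods // e leq_add2r leqNgt hi.
Qed.

Lemma act_misses_last u i : misses i (act (rcons u i)).
Proof.
move=> p; rewrite act_rcons /step; have [e|//] := eqVneq (cl (act u p)) i.
by rewrite clS e ordS_neq.
Qed.

Lemma act_nonsurj u : u != [::] -> nonsurj (act u).
Proof. by case/lastP: u => // u i _; exists i; apply: act_misses_last. Qed.

Lemma nonsurj_id : ~ nonsurj id.
Proof. by move=> [i /(_ i)]; rewrite cl_ord eqxx. Qed.

(** Going around the cycle from a missed class to the class of a value, one
    crosses the border between missed and attained classes. *)
Lemma misses_border f : nonsurj f ->
  exists2 i, misses i f & ~ misses (ordS i) f.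
Proof.
move=> [i fi]; apply: contrapT => no.
have {}no k : misses (cl (i + k)) f.
  elim: k => [|k IH]; first by rewrite addn0 cl_ord.
  by rewrite addnS clS; apply: contrapT => ?; apply: no; exists (cl (i + k)).
have [q /andP[/ltnW iq _] e] := cl_between i (cl (f 0)).
by have := no (q - i) 0; rewrite subnKC // e eqxx.
Qed.

(** * Lowering the values of a map *)

(** The condition [p < f p] keeps the lowered map above the identity; it also
    makes the predecessor harmless at 0. *)
Definition low i f p :=
  if (cl (f p) == ordS i) && (p < f p) then (f p).-1 else f p.

Lemma low_le i f p : low i f p <= f p.
Proof. by rewrite /low; case: ifP => // _; apply: leq_pred. Qed.

Lemma eq_low i f g : f =1 g -> low i f =1 low i g.
Proof. by move=> e p; rewrite /low e. Qed.

Lemma catalan_low i f : catalan f -> catalan (low i f).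
Proof.
move=> [mono per ext]; split=> [p q pq|p|p].
- have := mono p q pq; rewrite leq_eqVlt => /orP[/eqP e|lt].
    rewrite /low -e; case: (cl (f p) == _) => //=.
    have [qf|_] := ltnP q (f p); first by rewrite (leq_ltn_trans pq qf).
    by case: ifP => // _; apply: leq_pred.
  apply: leq_trans (low_le i f p) _; rewrite /low; case: ifP => _.
    by rewrite -ltnS (leq_trans lt) // leqSpred.
  exact: ltnW.
- rewrite /low per cl_addn ltn_add2r; case: ifP => // /andP[_ lt].
  by rewrite -!subn1 addnBAC // (leq_trans _ lt).
- by rewrite /low; case: ifP => // /andP[_ lt]; rewrite -ltnS (ltn_predK lt).
Qed.

Lemma step_low i f : misses i f -> step i \o low i f =1 f.
Proof.
move=> fi p /=; rewrite /low; case: ifP => [/andP[/eqP e lt]|_].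
  by rewrite step_eq ?(cl_pred lt e) // (ltn_predK lt).
by rewrite step_neq.
Qed.

(** If all values in the class [i + 1] were fixed points, the preceding argument
    of such a fixed point could only take a value in the missed class [i]. *)
Lemma low_lt i f : catalan f -> misses i f -> ~ misses (ordS i) f ->
  exists p, low i f p < f p.
Proof.
move=> catf fi hit; have [mono per ext] := catf.
have [p0 e0] : exists p, cl (f p) = ordS i.
  apply: contrapT => no; apply: hit => p; apply/eqP => e.
  by apply: no; exists p.
have [[|p] // _ e] := catalan_hit catf e0 1.
have gotcha q : cl (f q) = ordS i -> q < f q -> low i f q < f q.
  by move=> eq lt; rewrite /low eq eqxx lt /= ltn_predL (leq_trans _ lt).
have := ext p.+1; rewrite leq_eqVlt => /orP[/eqP fix_p|]; last first.
  by move=> lt; exists p.+1; apply: gotcha.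
have clp : cl p = i by apply/ordS_inj; rewrite -clS fix_p.
have fp : f p = p.+1.
  apply/eqP; rewrite eqn_leq {1}fix_p mono //=.
  rewrite ltn_neqAle ext andbT; apply: contraTneq (fi p) => <-.
  by rewrite clp eqxx.
by exists p; apply: gotcha; rewrite fp // clS clp.
Qed.

(** If [low i f] attains the class [i + 1], it has a fixed point there, because
    it lowers all other values of this class.  If it is not the identity either, a
    first moved point after this fixed point leaves a gap in the values. *)
Lemma low_nonsurj i f : catalan f -> misses i f ->
  nonsurj (low i f) \/ low i f =1 id.
Proof.
move=> catf fi; have catl := catalan_low i catf; have [_ _ extl] := catl.
have [miss|hit] := pselect (misses (ordS i) (low i f)).
  by left; exists (ordS i).
have [|notid] := pselect (low i f =1 id); [by right|left].
have [p fixp] : exists p, low i f p = p.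
  apply: contrapT => no; apply: hit => p; apply/eqP.
  rewrite /low; case: ifP => [/andP[/eqP e lt]|].
    by rewrite (cl_pred lt e) => /eqP; rewrite eq_sym ordS_neq.
  move=> nlt e; move: nlt; rewrite e eqxx /= => /negbT.
  rewrite -leqNgt => fle; apply: no; exists p; apply/eqP.
  by rewrite eqn_leq extl (leq_trans (low_le _ _ _) fle).
have [r lo] : exists r, r < low i f r.
  apply: contrapT => no; apply: notid => r; apply/eqP.
  by rewrite eqn_leq extl andbT leqNgt; apply/negP => ?; apply: no; exists r.
have exq : exists d, p + d < low i f (p + d).
  have le : p <= r + p * n.
    by rewrite (leq_trans _ (leq_addl _ _)) // leq_pmulr ?n_gt0.
  by exists (r + p * n - p); rewrite subnKC // (catalan_periods _ _ catl) ltn_add2r.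
case: (ex_minnP exq) => [[|d]]; first by rewrite addn0 fixp ltnn.
move=> gt min; exists (cl (p + d.+1)); rewrite addnS.
apply: (@misses_gap _ (p + d)) => //; rewrite -addnS gt andbT.
rewrite addnS ltnS leqNgt; apply/negP => /min.
by rewrite ltnn.
Qed.

Definition deg f := \sum_(p < n) f p.

Lemma eq_deg f g : f =1 g -> deg f = deg g.
Proof. by move=> e; apply: eq_bigr => p _. Qed.

Lemma deg_le f g : (forall p, f p <= g p) -> deg f <= deg g.
Proof. by move=> le; apply: leq_sum => p _. Qed.

Lemma deg_lt f g p : catalan f -> catalan g -> (forall p, f p <= g p) ->
  f p < g p -> deg f < deg g.
Proof.
move=> catf catg le lt; rewrite /deg (bigD1 (cl p)) //= [ltnRHS](bigD1 (cl p)) //=.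
rewrite -addSn leq_add //; last by apply: leq_sum.
move: lt; rewrite {1 2}(divn_eq p n) [_ * n + _]addnC.
by rewrite (catalan_periods _ _ catf) (catalan_periods _ _ catg) ltn_add2r.
Qed.

Lemma deg_low_lt i f : catalan f -> misses i f -> ~ misses (ordS i) f ->
  deg (low i f) < deg f.
Proof.
move=> catf fi hit; have [p lt] := low_lt catf fi hit.
by apply: deg_lt lt => //; [apply: catalan_low|apply: low_le].
Qed.

(** Factor [f] as [step i \o low i f] and induct on the degree. *)
Lemma word_of f : catalan f -> nonsurj f \/ f =1 id -> exists u, act u =1 f.
Proof.
have [d] := ubnP (deg f); elim: d f => // d IH f fd catf [ns|fid]; last first.
  by exists [::] => p; rewrite fid.
have [i fi hit] := misses_border ns.
have [] := IH (low i f) _ (catalan_low i catf) (low_nonsurj catf fi).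
  by rewrite -ltnS (leq_trans _ fd) // ltnS deg_low_lt.
move=> u uE; exists (rcons u i) => p.
by rewrite act_rcons uE -[RHS](step_low fi).
Qed.

Lemma word_low i f : catalan f -> misses i f -> exists u, act u =1 low i f.
Proof.
by move=> catf fi; apply: word_of; [apply: catalan_low|apply: low_nonsurj].
Qed.

(** * Faithfulness of the action *)

Local Notation "u ~ v" := (hkc_cong u v) (at level 70).

Lemma cong_rcons u v i : u ~ v -> rcons u i ~ rcons v i.
Proof.
by move=> uv; rewrite -!cats1; apply: hkc_cong_cat => //; apply: hkc_cong_refl.
Qed.

Lemma cong_suffix w u v : hkc_rel u v -> w ++ u ~ w ++ v.
Proof.
by move=> uv; apply: hkc_cong_cat (hkc_cong_refl w) (hkc_cong_rel uv).
Qed.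

Lemma cong_comm u i j : i != j -> j != ordS i -> i != ordS j ->
  rcons (rcons u i) j ~ rcons (rcons u j) i.
Proof.
by move=> ij ji ij'; rewrite -!cats1 -!catA; apply: cong_suffix; apply: hkc_comm.
Qed.

Lemma hit_actS u i : ~ misses i (act u) -> ~ misses (ordS i) (act (rcons u i)).
Proof.
move=> hit miss; apply: hit => p; apply/eqP => e.
by have := miss p; rewrite act_rcons step_eq // clS e eqxx.
Qed.

Lemma misses_act_belast u i j : misses j (act (rcons u i)) -> j != i ->
  misses j (act u).
Proof.
move=> miss ji p; apply/eqP => e; have := miss p.
by rewrite act_rcons step_neq ?e ?eqxx.
Qed.

(** Induct on [u], with last letter [a] after a word [u'].  The word [u'] misses
    [i], hence absorbs it, unless [i = a].  If [i = a + 1], then [u'] misses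
    [a] as well, and [a] can be dropped; otherwise a relation between [i] and [a]
    turns [u' i a i] or [u' a i] into [u' i a], that is, into [u' a]. *)
Lemma cong_absorb u i : misses i (act u) -> rcons u i ~ u.
Proof.
elim/last_ind: u i => [|u a IH] i miss.
  by case: nonsurj_id; exists i.
have [->|ia] := eqVneq i a.
  by rewrite -!cats1 -!catA; apply: cong_suffix; apply: hkc_idem.
have u_i := misses_act_belast miss ia.
have [e|ia'] := eqVneq i (ordS a).
  have u_a : misses a (act u).
    by apply: contrapT => /hit_actS; rewrite -e; apply.
  have ua := IH a u_a.
  by apply: hkc_cong_trans (cong_rcons i ua) 
           (hkc_cong_trans (IH i u_i) (hkc_cong_sym ua)).
have ui := cong_rcons a (IH i u_i).
have [e|ai] := eqVneq a (ordS i); last first.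
  by apply: hkc_cong_trans (cong_comm u _ ia' ai) ui; rewrite eq_sym.
apply: hkc_cong_trans (cong_rcons i (hkc_cong_sym ui)) _.
apply: hkc_cong_trans _ ui.
by rewrite -!cats1 -!catA e; apply: cong_suffix; apply: hkc_braidl.
Qed.

Lemma act_inj_nil u : act u =1 id -> u = [::].
Proof.
move=> uid; apply/eqP; apply: contrapT => /negP/act_nonsurj[i iu].
by apply: nonsurj_id; exists i => p; have := iu p; rewrite uid.
Qed.

(** The trimmed word ends in a letter that acts effectively, so that dropping it
    lowers the degree. *)
Lemma cong_trim u : u != [::] ->
  exists u' i, u ~ rcons u' i /\ ~ misses i (act u').
Proof.
elim/last_ind: u => // u i IH _.
have [miss|hit] := pselect (misses i (act u)); last first.
  by exists u, i; split=> //; apply: hkc_cong_refl.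
have [|u' [j [uj hit]]] := IH.
  by apply: contraPneq miss => -> miss; apply: nonsurj_id; exists i.
by exists u', j; split=> //; apply: hkc_cong_trans (cong_absorb miss) uj.
Qed.

Lemma misses_act_rcons u i j : misses j (act u) -> j != ordS i ->
  misses j (act (rcons u i)).
Proof.
move=> uj ji p; rewrite act_rcons /step.
have [e|_] := eqVneq (cl (act u p)) i; last exact: uj.
by rewrite clS e eq_sym.
Qed.

Lemma hit_act_belast u i j : ~ misses j (act u) -> j != i ->
  ~ misses j (act (rcons u i)).
Proof. by move=> hit ji miss; apply: hit; apply: misses_act_belast miss ji. Qed.

Lemma act_le_rcons u i p : act u p <= act (rcons u i) p.
Proof. by rewrite act_rcons step_ge. Qed.

Lemma deg_act_rcons u i : ~ misses i (act u) ->
  deg (act u) < deg (act (rcons u i)).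
Proof.
move=> hit.
have [p e] : exists p, cl (act u p) = i.
  apply: contrapT => no; apply: hit => p; apply/eqP => e.
  by apply: no; exists p.
apply: (@deg_lt _ _ p) => [||q|]; try exact: catalan_act.
  exact: act_le_rcons.
by rewrite act_rcons step_eq.
Qed.

Lemma step_low_comm a b v : b != a -> a != ordS b ->
  forall p, step a (low b (act v) p) = low b (act (rcons v a)) p.
Proof.
move=> ba ab p; rewrite /low act_rcons.
have [e|ne] := eqVneq (cl (act v p)) a.
  by rewrite (step_eq e) clS e ordS_eq (eq_sym a b) (negbTE ba) (negbTE ab) step_eq.
rewrite (step_neq ne); case: ifP => [/andP[/eqP e lt]|_].
  by rewrite step_neq // (cl_pred lt e).
by rewrite step_neq.
Qed.

(** By monotonicity no argument before a fixed point [p] reaches [p + 1]. *)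
Lemma fixed_blocks f p q : catalan f -> f p = p -> cl (f q) = ordS (cl p) ->
  f q <= q.
Proof.
move=> catf fixp; rewrite -clS => /cl_cofinal[k [l e]]; rewrite leqNgt.
apply/negP => lt; have [mono _ _] := catf.
have /mono : q + k * n <= p + l * n.
  by rewrite -ltnS -[(p + _).+1]addSn -e ltn_add2r.
by rewrite !(catalan_periods _ _ catf) e fixp addSn ltnn.
Qed.

(* One step of the induction on the degree of the common action of two words. *)
Section FaithfulStep.
Variable d : nat.
Hypothesis IH : forall u v, deg (act u) < d -> act u =1 act v -> u ~ v.

(** Write [u] as a word ending in [b]; since [a] and [b] commute, the last two
    letters can be exchanged. *)
Lemma cong_swap_last u v a b :
    ~ misses a (act u) -> deg (act (rcons u a)) <= d ->
    misses b (act u) -> ~ misses (ordS b) (act u) ->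
    b != a -> a != ordS b -> b != ordS a ->
    act v =1 low b (act (rcons u a)) ->
  rcons u a ~ rcons v b.
Proof.
move=> hit fd ub hitS ba ab ba' vE.
have ud : deg (act u) < d by apply: leq_trans (deg_act_rcons hit) fd.
have [h hE] := word_low (catalan_act u) ub.
have uh : u ~ rcons h b.
  by apply: IH => // p; rewrite act_rcons hE -[LHS](step_low ub).
have hv : rcons h a ~ v.
  have e p : act (rcons h a) p = low b (act (rcons u a)) p.
    by rewrite act_rcons hE step_low_comm.
  apply: IH => [|p]; last by rewrite e vE.
  rewrite (eq_deg e); apply: leq_trans fd; apply: deg_low_lt.
  - exact: catalan_act.
  - exact: misses_act_rcons.
  - by apply: hit_act_belast; rewrite // eq_sym.
apply: hkc_cong_trans (cong_rcons a uh) _.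
by apply: hkc_cong_trans (cong_comm _ _ _ _) (cong_rcons b hv).
Qed.

(** With [f] the action of [u a], the word [v] stands for the lowest of all maps
    [g] such that [f = step a \o g], and [u] for any of them.  If [u] is not the
    lowest one, it attains both [a] and [a + 1]; so it misses some [b] distinct
    from [a] and [a + 1] but attains [b + 1].  When [b] is not adjacent to [a],
    both [u a] and [v a] can be rewritten to end in [b].  When [a = b + 1], the
    word [u] ends in [a b] up to congruence, and the braid relation
    [a b a = b a] applies. *)
Lemma cong_low_last u v a :
    ~ misses a (act u) -> deg (act (rcons u a)) <= d ->
    act v =1 low a (act (rcons u a)) ->
  rcons u a ~ rcons v a.
Proof.
move=> hit fd vE; have catu := catalan_act u; have [_ _ ext] := catu.
have ud : deg (act u) < d by apply: leq_trans (deg_act_rcons hit) fd.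
have [e|] := pselect (act u =1 act v); first by apply/cong_rcons/IH.
(* A value in the class [a + 1] that the lowest map would have lowered. *)
move=> ne; have [p1 ne1] : exists p, act u p <> act v p.
  apply: contrapT => no; apply: ne => p; apply: contrapT => nep.
  by apply: no; exists p.
have [e1 lt1] : cl (act u p1) = ordS a /\ p1 < act u p1.
  move: ne1; rewrite vE /low act_rcons.
  have [e|nea] := eqVneq (cl (act u p1)) a.
    by rewrite (step_eq e) clS e eqxx ltnS ext.
  by rewrite (step_neq nea); case: ifP => // /andP[/eqP].
have u0 : u != [::] by apply: contraTneq lt1 => ->; rewrite ltnn.
have [b ub hitS] := misses_border (act_nonsurj u0).
have ba : b != a by apply: contraPneq ub => ->.
have ba' : b != ordS a.
  by apply: contraPneq ub => -> /(_ p1); rewrite e1 eqxx.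
have fa : misses a (act (rcons u a)) by apply: act_misses_last.
have [ab|ab] := eqVneq a (ordS b); last first.
  have [z zE] : exists z, act z =1 low b (act (rcons u a)).
    by apply: word_low; [apply: catalan_act|apply: misses_act_rcons].
  have vf : act (rcons v a) =1 act (rcons u a).
    by move=> p; rewrite act_rcons vE -[RHS](step_low fa).
  apply: hkc_cong_trans (cong_swap_last hit fd ub hitS ba ab ba' zE) _.
  apply: hkc_cong_sym; apply: cong_swap_last => //.
  - move=> miss; apply: hit => p; apply/eqP => e; have := miss p.
    by rewrite vE /low act_rcons (step_eq e) clS e eqxx ltnS ext /= e eqxx.
  - by rewrite (eq_deg vf).
  - move=> p; rewrite vE /low; case: ifP => [/andP[/eqP e lt]|_].
      by rewrite (cl_pred lt e) eq_sym.
    exact: misses_act_rcons.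
  - move=> miss; apply: (hit_act_belast hitS (i := a)); first by rewrite eq_sym.
    move=> p; apply/eqP => e; have := miss p; rewrite vE /low e.
    by rewrite ordS_eq (negbTE ba) /= e eqxx.
  - by move=> p; rewrite zE; apply: eq_low.
subst a.
(* A fixed point in the class [b + 1] would keep [p1] from reaching the class
   [b + 2]; hence lowering at [b] clears the class [b + 1] altogether. *)
have [h hE] := word_low catu ub.
have hb p : cl (act u p) = ordS b -> p < act u p.
  move=> e; rewrite ltn_neqAle ext andbT; apply/eqP => fixp.
  have := fixed_blocks (p := p) (q := p1) catu (esym fixp).
  by rewrite e1 fixp e leqNgt lt1; move/(_ erefl).
have uh : u ~ rcons h b.
  by apply: IH => // p; rewrite act_rcons hE -[LHS](step_low ub).
have hd : deg (act h) <= deg (act u).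
  by rewrite (eq_deg hE); apply: deg_le; apply: low_le.
have ha : misses (ordS b) (act h).
  move=> p; rewrite hE /low; apply/eqP.
  case: ifP => [/andP[/eqP e lt]|nlt e].
    by rewrite (cl_pred lt e) => /eqP; rewrite eq_sym ordS_neq.
  by move: nlt; rewrite e eqxx /= hb.
have [k kE] := word_low (catalan_act h) ha.
have hk : h ~ rcons k (ordS b).
  apply: IH => [|p]; first exact: leq_ltn_trans hd ud.
  by rewrite act_rcons kE -[LHS](step_low ha).
have kv : rcons k b ~ v.
  apply: hkc_cong_sym; apply: IH => [|p].
    rewrite (eq_deg vE); apply: leq_trans fd; apply: deg_low_lt => //.
      exact: catalan_act.
    by apply: hit_actS.
  rewrite vE act_rcons kE /low act_rcons hE /low.
  have [e|nep] := eqVneq (cl (act u p)) (ordS b).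
    have lt := hb p e.
    rewrite lt (step_eq e) clS e eqxx ltnS ext /= (cl_pred lt e).
    by rewrite eq_sym ordSS_neq /= step_eq ?(cl_pred lt e) // (ltn_predK lt).
  rewrite (step_neq nep) /=.
  case: ifP => [/andP[/eqP e lt]|_]; last by rewrite step_neq.
  by rewrite step_neq // (cl_pred lt e) ordS_neq.
apply: hkc_cong_trans (cong_rcons _ uh) _.
apply: hkc_cong_trans (cong_rcons _ (cong_rcons _ hk)) _.
apply: hkc_cong_trans (cong_rcons _ kv).
by rewrite -!cats1 -!catA; apply: cong_suffix; apply: hkc_braidr.
Qed.

(** After trimming, both words end in effective letters [a] and [b], and by
    [cong_low_last] what precedes them may be taken to be a lowering of the
    common action.  If [a] and [b] differ they are not adjacent: the action
    misses both and attains both successors. *)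
Lemma act_faithful_step u v : deg (act u) <= d -> act u =1 act v -> u ~ v.
Proof.
move=> ud uv; have [u0|u0] := eqVneq u [::].
  by rewrite u0 (@act_inj_nil v) => [|p]; [apply: hkc_cong_refl|rewrite -uv u0].
have v0 : v != [::].
  by apply: contraNneq u0 => v0; rewrite (@act_inj_nil u) // => p; rewrite uv v0.
have [u' [a [ua hita]]] := cong_trim u0.
have [v' [b [vb hitb]]] := cong_trim v0.
have uE := act_cong ua; have vE := act_cong vb.
have uv' p : act (rcons v' b) p = act (rcons u' a) p by rewrite -uE -vE uv.
have {}ud : deg (act (rcons u' a)) <= d by rewrite -(eq_deg uE).
have vd : deg (act (rcons v' b)) <= d by rewrite (eq_deg uv').
apply: hkc_cong_trans ua _; apply: hkc_cong_trans (hkc_cong_sym vb).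
have fa : misses a (act (rcons u' a)) by apply: act_misses_last.
have fb : misses b (act (rcons u' a)).
  by move=> p; rewrite -uv'; apply: act_misses_last.
have hitSa : ~ misses (ordS a) (act (rcons u' a)) by apply: hit_actS.
have hitSb : ~ misses (ordS b) (act (rcons u' a)).
  by move=> miss; apply: (hit_actS hitb) => p; rewrite uv'.
have catf := catalan_act (rcons u' a).
have [x xE] := word_low catf fa; have [y yE] := word_low catf fb.
have ux : rcons u' a ~ rcons x a by apply: cong_low_last.
have vy : rcons v' b ~ rcons y b.
  by apply: cong_low_last => // p; rewrite yE; apply: eq_low => q.
apply: hkc_cong_trans ux _; apply: hkc_cong_trans (hkc_cong_sym vy).
have [ab|ab] := eqVneq a b.
  subst b; apply: cong_rcons; apply: IH => [|p]; last by rewrite xE yE.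
  by rewrite (eq_deg xE); apply: leq_trans ud; apply: deg_low_lt.
have xf : act (rcons x a) =1 act (rcons u' a).
  by move=> p; rewrite act_rcons xE -[RHS](step_low fa).
have aSb : a != ordS b by apply/eqP => e; apply: hitSb; rewrite -e.
have bSa : b != ordS a by apply/eqP => e; apply: hitSa; rewrite -e.
apply: cong_swap_last => //.
- move=> miss; have [p lt] := low_lt catf fa hitSa.
  have := miss p; rewrite xE /low; move: lt; rewrite /low.
  case: ifP => [/andP[/eqP e lt] _|]; last by rewrite ltnn.
  by rewrite (cl_pred lt e) eqxx.
- by rewrite (eq_deg xf).
- move=> p; rewrite xE /low; case: ifP => [/andP[/eqP e lt]|_].
    by rewrite (cl_pred lt e).
  exact: fb.
- move=> miss; apply: hitSb => p; apply/eqP => e; have := miss p.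
  by rewrite xE /low e ordS_eq (eq_sym b) (negbTE ab) /= e eqxx.
- by rewrite eq_sym.
- by move=> p; rewrite yE; apply: eq_low.
Qed.

End FaithfulStep.

Theorem act_faithful u v : act u =1 act v -> u ~ v.
Proof.
have [d] := ubnP (deg (act u)); elim: d u v => // d IH u v.
by rewrite ltnS; apply: act_faithful_step.
Qed.

(** * Translations by multiples of the period *)

Fixpoint last_below (P : pred nat) m :=
  if P m then m else if m is m'.+1 then last_below P m' else 0.

Lemma last_below_le (P : pred nat) m : last_below P m <= m.
Proof. by elim: m => [|m IH] /=; case: ifP => // _; apply: leqW. Qed.

Lemma last_belowP (P : pred nat) m (p : nat) : P p -> p <= m ->
  p <= last_below P m /\ P (last_below P m).
Proof.
move=> Pp; elim: m => [|m IH] /=.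
  by rewrite leqn0 => /eqP p0; rewrite -p0 Pp.
rewrite leq_eqVlt => /orP[/eqP <-|]; first by rewrite Pp.
by move=> pm; have := IH pm; case: ifP => // Pm _; rewrite ltnW.
Qed.

(** Take for [h p] the largest number in a class attained by [f], among those
    that are at most [p + k * n]. *)
Lemma right_translation f i k : catalan f -> misses i f -> 0 < k ->
  exists h, [/\ catalan h, nonsurj h, forall p, h p <= p + k * n
              & forall p, h (f p) = f p + k * n].
Proof.
move=> catf fi k0; pose P q := `[< exists p, cl (f p) = cl q >].
have Pf p : P (f p) by apply/asboolP; exists p.
have P_shift q l : P (q + l * n) = P q by rewrite /P cl_shift.
pose h p := last_below P (p + k * n).
have le_kn p : p + n <= p + k * n by rewrite leq_add2l leq_pmull.
have h_in p : p < h p /\ P (h p).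
  have [q /andP[lo hi] e] := cl_between p (cl (f 0)).
  have Pq : P q by apply/asboolP; exists 0.
  have [] := last_belowP Pq (leq_trans hi (le_kn p)).
  by move=> /(leq_trans lo).
have h_max p q : P q -> q <= p + k * n -> q <= h p.
  by move=> Pq le; have [] := last_belowP Pq le.
have h_le p : h p <= p + k * n by apply: last_below_le.
exists h; split=> // [|| p]; last first.
- by apply/eqP; rewrite eqn_leq h_le h_max ?P_shift.
- by exists i => p; have [_ /asboolP[q <-]] := h_in p; exact: fi.
split=> [p q pq|p|p]; last by have [/ltnW] := h_in p.
  by apply: h_max; [have [] := h_in p|rewrite (leq_trans (h_le p)) ?leq_add2r].
have [lt Ph] := h_in (p + n).
have nh : n <= h (p + n) by rewrite (leq_trans _ (ltnW lt)) ?leq_addl.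
have Pn q : P (q + n) = P q by rewrite -[n in q + n]mul1n P_shift.
apply/eqP; rewrite eqn_leq; apply/andP; split.
  rewrite [leqRHS]addnC -leq_subLR; apply: h_max; first by rewrite -Pn subnK.
  by rewrite leq_subLR addnA [n + p]addnC.
by apply: h_max; [have [_] := h_in p; rewrite Pn|rewrite addnAC leq_add2r].
Qed.

(** Take for [h p] the least [q] with [f q >= f p + k * n]; as [p + k * n] is
    such a [q], the value there is exactly [f p + k * n].  The least argument of
    a value never lies in the class of [j + 1]. *)
Lemma left_translation f (j k : nat) : catalan f -> f j = f j.+1 -> 0 < k ->
  exists h, [/\ catalan h, nonsurj h, forall p, h p <= p + k * n
              & forall p, f (h p) = f p + k * n].
Proof.
move=> catf fj k0; have [mono per ext] := catf.
pose P p q := f q < f p + k * n.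
pose h p := (last_below (P p) (p + k * n)).+1.
have Pp p : P p p by rewrite /P -[ltnLHS]addn0 ltn_add2l muln_gt0 k0 n_gt0.
have fkn p : f (p + k * n) = f p + k * n by rewrite catalan_periods.
have h_in p : p < h p /\ P p (h p).-1.
  by have [] := last_belowP (Pp p) (leq_addr (k * n) p).
have h_P p q : q < h p -> P p q.
  move=> lt; have [_] := h_in p; apply: leq_ltn_trans; apply: mono.
  by rewrite -ltnS (ltn_predK lt).
have h_le p : h p <= p + k * n.
  rewrite ltnNge; apply/negP => le; have [_] := h_in p.
  by rewrite /P ltnNge -fkn mono.
have h_max p q : P p q -> q < h p.
  move=> Pq; have le : q <= p + k * n.
    rewrite leqNgt; apply/negP => /ltnW /mono.
    by rewrite fkn leqNgt -/(P p q) Pq.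
  by have [] := last_belowP Pq le.
have fh p : f (h p) = f p + k * n.
  apply/eqP; rewrite eqn_leq -{1}fkn mono //= leqNgt; apply/negP.
  by move=> /h_max; rewrite ltnn.
exists h; split=> //; last first.
  exists (cl j.+1) => p; apply/eqP => /cl_cofinal[k1 [l e]].
  have [lt Ph] := h_in p; have hp : (h p).-1.+1 = h p := ltn_predK lt.
  have e' : (h p).-1 + k1 * n = j + l * n.
    by apply: succn_inj; rewrite -!addSn hp e.
  have : f ((h p).-1 + k1 * n) = f (h p + k1 * n).
    by rewrite e e' !(catalan_periods _ _ catf) fj.
  rewrite !(catalan_periods _ _ catf) fh => /addIn e2.
  by move: Ph; rewrite /P e2 ltnn.
split=> [p q pq|p|p]; last by have [/ltnW] := h_in p.
  have [_ Pp'] := h_in p; apply: h_max => //.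
  by apply: leq_trans Pp' _; rewrite leq_add2r mono.
apply/eqP; rewrite eqn_leq; apply/andP; split; rewrite leqNgt; apply/negP.
  by move=> /h_P; rewrite /P !per fh addnAC ltnn.
have [lt _] := h_in (p + n).
have nh : n <= h (p + n) by rewrite (leq_trans _ (ltnW lt)) ?leq_addl.
rewrite -{1}(subnK nh) ltn_add2r => /h_P.
rewrite /P -(ltn_add2r n) -per addnAC -per => /h_max.
by rewrite subnK ?ltnn.
Qed.

(** * An order on the monoid compatible with translations *)

Implicit Types x y z : hkc n.

Definition mact x : nat -> nat := act (repr x).

Lemma mact_word u : mact (hkc_word u) =1 act u.
Proof. by apply: act_cong; apply/hkc_wordP; rewrite hkc_reprK. Qed.

Lemma mact_mul x y p : mact (mmul x y) p = mact y (mact x p).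
Proof. by rewrite [mmul x y]/(hkc_mul x y) mact_word act_cat. Qed.

Lemma mact_inj x y : mact x =1 mact y -> x = y.
Proof.
by move=> /act_faithful/hkc_wordP; rewrite !hkc_reprK.
Qed.

Lemma catalan_mact x : catalan (mact x).
Proof. exact: catalan_act. Qed.

Definition lev x := mact x 0 %/ n.

(** The invariant of the chains [g, g + n, g + 2n, ...].  The values are
    below [2n] because [mact x p <= mact x 0 + n] for [p < n]. *)
Definition cls x : {ffun 'I_n -> 'I_(n + n).+1} :=
  [ffun p : 'I_n => inord (mact x p - lev x * n)].

(** The lexicographic order by degree and then by [cls], as a natural number. *)
Definition key x :=
  deg (mact x) * #|{ffun 'I_n -> 'I_(n + n).+1}| + enum_rank (cls x).

Lemma mactE x (p : 'I_n) : mact x p = cls x p + lev x * n.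
Proof.
have [mono per _] := catalan_mact x.
have lo : lev x * n <= mact x p.
  by apply: leq_trans (mono 0 p (leq0n p)); apply: leq_divM.
rewrite ffunE inordK ?subnK // ltnS leq_subLR.
have le : mact x p <= mact x (0 + n) by apply: mono; rewrite add0n ltnW.
apply: leq_trans le _; rewrite per {1}(divn_eq (mact x 0) n) -/(lev x).
by rewrite -addnA leq_add2l leq_add2r ltnW // ltn_pmod ?n_gt0.
Qed.

Lemma mact_cls x y k : cls x = cls y -> lev y = lev x + k ->
  forall p, mact y p = mact x p + k * n.
Proof.
move=> e l p; rewrite (divn_eq p n) [_ * n + _]addnC.
rewrite !(catalan_periods _ _ (catalan_mact _)).
have := mactE x (cl p); have := mactE y (cl p); rewrite /= => -> ->.
by rewrite e l mulnDl addnA addnAC.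
Qed.

Lemma cls_shift x y k : (forall p, mact y p = mact x p + k * n) ->
  cls x = cls y.
Proof.
move=> e; have l : lev y = lev x + k.
  by rewrite /lev e addnC divnMDl ?n_gt0 // addnC.
by apply/ffunP => p; rewrite !ffunE e l mulnDl subnDr.
Qed.

Lemma deg_shift f g k : (forall p, g p = f p + k * n) ->
  deg g = deg f + n * (k * n).
Proof.
move=> e; rewrite /deg (eq_bigr (fun p : 'I_n => f p + k * n)) => [|p _].
  by rewrite big_split /= sum_nat_const card_ord.
exact: e.
Qed.

Lemma key_deg x y : deg (mact x) < deg (mact y) -> key x < key y.
Proof.
rewrite /key => lt; have r := ltn_ord (enum_rank (cls x)).
apply: leq_trans (leq_addr _ _); move: r; set c := #|_| => r.
apply: (@leq_trans ((deg (mact x)).+1 * c)); last by rewrite leq_mul2r lt orbT.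
by rewrite mulSn [ltnRHS]addnC ltn_add2l.
Qed.

Lemma key_le_deg x y : key x <= key y -> deg (mact x) <= deg (mact y).
Proof. by move=> le; rewrite leqNgt; apply/negP => /key_deg; rewrite ltnNge le. Qed.

Lemma lev_deg x y : cls x = cls y -> deg (mact x) <= deg (mact y) ->
  lev x <= lev y.
Proof.
move=> e; apply: contraTT; rewrite -!ltnNge => lt.
have eqm := mact_cls (esym e) (esym (subnKC (ltnW lt))).
rewrite (deg_shift eqm) -[ltnLHS]addn0 ltn_add2l !muln_gt0 subn_gt0 lt.
by rewrite n_gt0.
Qed.

Lemma key_inj : injective key.
Proof.
move=> x y e.
have d : deg (mact x) = deg (mact y).
  by apply/eqP; rewrite eqn_leq !key_le_deg ?e.
have c : cls x = cls y.
  by apply/enum_rank_inj/val_inj; apply/eqP; rewrite -(eqn_add2l (deg (mact x) *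
    #|{ffun 'I_n -> 'I_(n + n).+1}|)) [in X in _ == X]d -/(key x) -/(key y) e.
have l : lev y = lev x + 0.
  by apply/eqP; rewrite addn0 eqn_leq !lev_deg ?d ?c.
by apply: mact_inj => p; rewrite (mact_cls c l) addn0.
Qed.

(** Either [t] is the exact translate of [z], and translation preserves the
    order, or its degree is smaller than that of the translate. *)
Lemma key_translate x y z t k :
    (forall p, mact t p <= mact z p + k * n) ->
    (forall p, mact y p = mact x p + k * n) ->
    key z < key x -> key t < key y.
Proof.
move=> le yE zx; have dy := deg_shift yE.
have zx' := key_le_deg (ltnW zx).
have [tE|] := pselect (forall p, mact t p = mact z p + k * n).
  move: zx; rewrite /key -(cls_shift tE) -(cls_shift yE) dy (deg_shift tE).
  by rewrite !mulnDl -!addnA ![n * (k * n) * _ + _]addnC !addnA ltn_add2r.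
move=> ne; apply: key_deg; rewrite dy.
apply: (@leq_trans (deg (mact z) + n * (k * n))); last by rewrite leq_add2r.
rewrite -(@deg_shift _ (fun p => mact z p + k * n) k) //.
have [p lt] : exists p, mact t p < mact z p + k * n.
  apply: contrapT => no; apply: ne => p; apply/eqP; rewrite eqn_leq le /=.
  by rewrite leqNgt; apply/negP => ?; apply: no; exists p.
apply: deg_lt lt => //; first exact: catalan_mact.
have [mono per ext] := catalan_mact z.
split=> [q r qr|q|q]; first by rewrite leq_add2r mono.
  by rewrite per addnAC.
exact: leq_trans (ext q) (leq_addr _ _).
Qed.

(** The identity is alone in its chain, as its translates attain all classes; so
    [x] is not the identity here. *)
Lemma cls_translation x y : cls x = cls y -> key x <= key y -> x <> y ->
  repr x != [::] /\ exists2 k, 0 < k & forall p, mact y p = mact x p + k * n.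
Proof.
move=> e le ne; have l := lev_deg e (key_le_deg le).
have yE := mact_cls e (esym (subnKC l)).
have k0 : 0 < lev y - lev x.
  rewrite lt0n; apply/eqP => k0; apply: ne; apply: mact_inj => p.
  by rewrite yE k0 addn0.
split; last by exists (lev y - lev x).
apply/eqP => x0; have idx p : mact x p = p by rewrite /mact x0.
have [y0|/act_nonsurj[i]] := eqVneq (repr y) [::].
  by have := yE 0; rewrite idx {1}/mact y0 /= => /esym/eqP; rewrite muln_eq0
    -leqn0 leqNgt k0 /= -leqn0 leqNgt n_gt0.
by move=> /(_ i); rewrite -/(mact y) yE idx cl_shift cl_ord eqxx.
Qed.

Lemma right_shift x y : cls x = cls y -> key x <= key y ->
  exists2 h, mmul x h = y & forall z, key z < key x -> key (mmul z h) < key y.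
Proof.
move=> e le; have [->|/eqP ne] := eqVneq x y.
  by exists mone => [|z]; rewrite mulm1.
have [x0 [k k0 yE]] := cls_translation e le ne.
have [i xi] := act_nonsurj x0.
have [h [cath hns h_le hx]] := right_translation (catalan_mact x) xi k0.
have [w wE] := word_of cath (or_introl hns).
exists (hkc_word w) => [|z].
  by apply: mact_inj => p; rewrite mact_mul mact_word wE hx yE.
by apply: key_translate yE => p; rewrite mact_mul mact_word wE.
Qed.

(** The first letter [i] already merges [i] and [i + 1]. *)
Lemma act_kernel u : u != [::] -> exists p, act u p = act u p.+1.
Proof.
case: u => // i u _; exists i; rewrite /act /= step_eq ?cl_ord // step_neq //.
by rewrite clS cl_ord ordS_neq.
Qed.

Lemma left_shift x y : cls x = cls y -> key x <= key y ->
  exists2 h, mmul h x = y & forall z, key z < key x -> key (mmul h z) < key y.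
Proof.
move=> e le; have [->|/eqP ne] := eqVneq x y.
  by exists mone => [|z]; rewrite mul1m.
have [x0 [k k0 yE]] := cls_translation e le ne.
have [r xr] := act_kernel x0.
have [h [cath hns h_le hx]] := left_translation (catalan_mact x) xr k0.
have [w wE] := word_of cath (or_introl hns).
exists (hkc_word w) => [|z].
  by apply: mact_inj => p; rewrite mact_mul mact_word wE hx yE.
apply: key_translate yE => p; rewrite mact_mul mact_word wE.
have [mono _ _] := catalan_mact z.
by rewrite -(catalan_periods _ _ (catalan_mact z)) mono.
Qed.

End AffineCatalanMaps.

Theorem theorem5p9 (n : nat) (hn : (3 <= n)%N) (K : fieldType) :
  right_noetherian {malg K[hkc n]} /\ left_noetherian {malg K[hkc n]}.
Proof.
split.
  exact: right_noetherian_malg (@key_inj n hn) (@right_shift n hn).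
exact: left_noetherian_malg (@key_inj n hn) (@left_shift n hn).
Qed.
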